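(* Let $\eta=(\eta_1,\dots,\eta_{\ell(\eta)})\vdash n$ be a partition (with $\eta_1\ge\eta_2\ge\cdots\ge\eta_{\ell(\eta)}\geq 1$). Assign a variable $u_i$ to the $i$th partite set (of size $\eta_i$) of the complete multipartite graph $K_\eta$, set $u=(u_1,\dots,u_{\ell(\eta)})$, and write $u^\eta=u_1^{\eta_1}\cdots u_{\ell(\eta)}^{\eta_{\ell(\eta)}}$. For each integer $j$ with $1\le j\le \eta_1$ let $$E_j=\frac1{j!}\sum_{\substack{1\le i\le \ell(\eta)\\ \eta_i\ge j}}u_i^j,$$ and let $y=(y_1,\dots,y_{\eta_1})$ be the sequence of roots of the polynomial $$z^{\eta_1}-E_1z^{\eta_1-1}+E_2z^{\eta_1-2}-\dots+(-1)^{\eta_1}E_{\eta_1}.$$ Then $$X_{K_\eta}=\eta!\sum_{\mu\vdash n}\bigl([u^\eta]\,m_\mu(y)\bigr)\,e_\mu(x),$$ where $\eta!=\prod_{i=1}^{\ell(\eta)}\eta_i!$.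
   Context: For a partition $\eta$, $\ell(\eta)$ is its number of parts and $K_\eta$ is the complete multipartite graph whose partite sets have sizes equal to the parts of $\eta$. For a finite simple graph $G=(V,E)$, the chromatic symmetric function is $X_G(x)=\sum_{\kappa}\prod_{v\in V}x_{\kappa(v)}$, where $x=(x_1,x_2,\dots)$ are commuting indeterminates and the sum is over all proper colorings $\kappa\colon V\to\mathbb Z_{>0}$. $e_\mu$ and $m_\mu$ denote the elementary and monomial symmetric functions; $m_\mu(y)$ is the specialization of $m_\mu$ to the finite alphabet $y$ (all further variables set to $0$, so $m_\mu(y)=0$ if $\ell(\mu)>\eta_1$). The $u_i$ are independent commuting indeterminates, and the roots $y_a$ are taken, with multiplicity, in a splitting algebra over $\mathbb Q[u_1,\dots,u_{\ell(\eta)}]$, so that the polynomial equals $\prod_{a=1}^{\eta_1}(z-y_a)$ and $e_j(y)=E_j$. Since $m_\mu(y)$ is symmetric in the roots, it is a polynomial in $E_1,\dots,E_{\eta_1}$ and hence an element of $\mathbb Q[u_1,\dots,u_{\ell(\eta)}]$; $[u^\eta]F$ denotes the coefficient of the monomial $u^\eta$ in $F$. *)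

(* Defs.v *)
From HB Require Import structures.
From mathcomp Require Import all_boot all_order all_algebra.
From mathcomp Require Import finmap multiset.
From mathcomp Require Import mpoly.

Set Implicit Arguments.
Unset Strict Implicit.
Unset Printing Implicit Defensive.

Import GRing.Theory.
Local Open Scope ring_scope.

Definition is_partition (n : nat) (mu : seq nat) : bool :=
  [&& sorted geq mu, all (leq 1) mu & sumn mu == n].

(* A partition of n has at most n parts, each of them at most n, so the
   partitions of n are found among the bounded sequences below. *)
Definition partitions (n : nat) : seq (seq nat) :=
  [seq mu <- [seq map val b | b : {bseq n of 'I_n.+1}] | is_partition n mu].

Lemma mem_partitions n mu : (mu \in partitions n) = is_partition n mu.
Proof.
rewrite mem_filter andb_idr // => /and3P[_ pos /eqP sum_mu].
have mem_le i : i \in mu -> (i < n.+1)%N.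
  by move=> imu; rewrite ltnS -sum_mu sumnE (big_rem i) //= leq_addr.
have size_le : (size mu <= n)%N.
  rewrite -sum_mu; elim: {sum_mu mem_le} mu pos => //= a s IHs /andP[a_gt0 /IHs].
  by rewrite -add1n => /(leq_add a_gt0).
have sz : (size [seq (inord i : 'I_n.+1) | i <- mu] <= n)%N by rewrite size_map.
apply/imageP; exists (Bseq sz) => //=.
by rewrite -map_comp -[LHS]map_id; apply/eq_in_map => i /mem_le /= /inordK ->.
Qed.

Lemma partitions_uniq n : uniq (partitions n).
Proof.
rewrite filter_uniq // map_inj_uniq ?enum_uniq //.
by move=> b c /(inj_map val_inj) /val_inj.
Qed.

(* Formal power series over rat in countably many variables x_0, x_1, ...
   (indexed from 0 instead of 1): the monomial x_(i_1) ... x_(i_d) is the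
   multiset {i_1, ..., i_d}, and a series is its coefficient function. *)
Notation monomial := (multiset nat).
Definition series : Type := monomial -> rat.

Definition divisors_of (m : monomial) : seq monomial :=
  undup [seq seq_mset (mask b m) | b : (size m).-tuple bool].

Lemma mem_divisors_of (d m : monomial) : (d \in divisors_of m) = msubset d m.
Proof.
rewrite mem_undup; apply/imageP/idP => [[b _ ->]|sub_dm].
  apply/msubsetP => i; rewrite mset_seqE.
  by rewrite -[X in (_ <= X)%N]count_mem_mset; apply: leq_count_subseq (mask_subseq _ _).
have /count_subseqP[s /subseqP[b /eqP sz_b def_s] perm_s] :
    forall i, (count_mem i (d : seq nat) <= count_mem i (m : seq nat))%N.
  by move=> i; rewrite !count_mem_mset; apply: (msubsetP sub_dm).
exists (Tuple sz_b) => //=.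
by rewrite -def_s -(eq_seq_msetP _ _ perm_s) seq_mset_id.
Qed.

Definition series_one : series := fun m => (m == mset0)%:R.

Definition series_mul (f g : series) : series := fun m =>
  \sum_(d <- divisors_of m) f d * g (msetB m d).

(* e_k, the sum of the products x_(i_1) ... x_(i_k) with distinct indices *)
Definition elem_sym (k : nat) : series := fun m =>
  (uniq (m : seq nat) && (size m == k))%:R.

Definition elem_sym_part (mu : seq nat) : series :=
  foldr series_mul series_one (map elem_sym mu).

(* m_mu(y_0, ..., y_(N-1)): the sum of y^alpha over the distinct
   rearrangements alpha of mu padded with zeros to length N. *)
Definition msym_at (S : comNzRingType) (N : nat) (y : 'I_N -> S)
    (mu : seq nat) : S :=
  if (size mu <= N)%N then
    \sum_(alpha <- permutations (mu ++ nseq (N - size mu) 0%N))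
      \prod_(a < N) y a ^+ nth 0%N alpha a
  else 0.

Record sgraph := SGraph {
  vertex :> finType;
  edge : rel vertex;
  edge_sym : forall u v, edge u v = edge v u;
  edge_irr : forall u, edge u u = false }.

Definition proper_coloring (G : sgraph) (C : eqType) (k : G -> C) : bool :=
  [forall u, forall v, edge u v ==> (k u != k v)].

(* The coefficient of m in X_G is the number of proper colorings k with
   \prod_v x_(k v) = m; by coloring_supp these take their values in the
   finite support of m. *)
Definition chromatic_sf (G : sgraph) : series := fun m =>
  #|[set k : {ffun G -> finsupp m} |
      proper_coloring k && (seq_mset [seq val (k v) | v : G] == m)]|%:R.

Lemma coloring_supp (G : sgraph) (k : G -> nat) (v : G) :
  k v \in finsupp (seq_mset [seq k w | w : G]).
Proof.
rewrite multiset.msuppE.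
by rewrite [_ \in _](perm_mem (perm_eq_seq_mset [seq k w | w : G])) image_f.
Qed.

Section Multipartite.
Variable eta : seq nat.

Definition multipartite_vertex : finType :=
  {i : 'I_(size eta) & 'I_(nth 0%N eta i)}.

Definition multipartite_edge : rel multipartite_vertex :=
  fun u v => tag u != tag v.

Lemma multipartite_edge_sym u v : multipartite_edge u v = multipartite_edge v u.
Proof. by rewrite /multipartite_edge eq_sym. Qed.

Lemma multipartite_edge_irr u : multipartite_edge u u = false.
Proof. by rewrite /multipartite_edge eqxx. Qed.

Definition complete_multipartite : sgraph :=
  SGraph multipartite_edge_sym multipartite_edge_irr.

Definition eta_mnm : 'X_{1..size eta} :=
  [multinom nth 0%N eta i | i < size eta].

Definition Ecoef (j : nat) : {mpoly rat[size eta]} :=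
  (j`!%:R : rat)^-1 *:
    \sum_(i < size eta | (j <= nth 0%N eta i)%N) 'X_i ^+ j.

(* The largest part eta_1 is head 0 eta, with value 0 when eta is empty. *)
Definition Epoly : {poly {mpoly rat[size eta]}} :=
  'X^(head 0%N eta) +
  \sum_(1 <= j < (head 0%N eta).+1)
    ((-1) ^+ j * Ecoef j) *: 'X^(head 0%N eta - j).

Definition part_fact : nat := (\prod_(i < size eta) (nth 0 eta i)`!)%N.

End Multipartite.

(* y lists, with multiplicity, the roots of P in the algebra S over R. *)
Definition splits_with_roots (R S : comNzRingType) (iota : {rmorphism R -> S})
    (P : {poly R}) (N : nat) (y : 'I_N -> S) : Prop :=
  injective iota /\ map_poly iota P = \prod_(a < N) ('X - (y a)%:P).

Section SplittingAlgebra.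
Variables (R : comNzRingType) (P : {poly R}).

Lemma horner_qpolyX (p : {poly R}) :
  (map_poly (qpolyC P) p).[qpolyX P] = in_qpoly P p.
Proof.
elim/poly_ind: p => [|p c IHp]; first by rewrite rmorph0 horner0 in_qpoly0.
rewrite rmorphD rmorphM /= map_polyX map_polyC /= hornerMXaddC IHp.
rewrite in_qpolyD in_qpolyM; congr (_ + _); apply: val_inj => /=.
by rewrite Pdiv.CommonRing.rmodp_small // size_polyC (leq_ltn_trans (leq_b1 _)) ?size_mk_monic_gt1.
Qed.

End SplittingAlgebra.

Lemma splitting_algebra_exists (N : nat) (R : comNzRingType) (P : {poly R}) :
    P \is monic -> size P = N.+1 ->
  exists (S : comNzRingType) (iota : {rmorphism R -> S}) (y : 'I_N -> S),
    splits_with_roots iota P y.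
Proof.
elim: N R P => [|N IHN] R P monP szP.
  exists R, idfun, (fun=> 0); split=> //; rewrite big_ord0 map_poly_id //.
  have := monicP monP; rewrite lead_coefE szP /= => P0.
  by rewrite (size1_polyC (eq_leq szP)) P0.
pose R1 : comNzRingType := {poly %/ P}.
pose j : {rmorphism R -> R1} := qpolyC P.
have P_id : mk_monic P = P by rewrite /mk_monic szP monP.
pose x : R1 := qpolyX P.
have /factor_theorem[Q defQ] : root (map_poly j P) x.
  rewrite /root horner_qpolyX; apply/eqP/val_inj => /=.
  by rewrite P_id Pdiv.RingMonic.rmodpp.
have monjP : map_poly j P \is monic by exact: monic_map.
have monQ : Q \is monic by move: monjP; rewrite defQ monicMr ?monicXsubC.
have szQ : size Q = N.+1.
  have := size_Mmonic (monic_neq0 monQ) (monicXsubC x).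
  rewrite -defQ size_XsubC addn2 /= size_map_poly_id0 ?szP => [[]//|].
  by rewrite (monicP monP) rmorph1 oner_neq0.
have [S [iota [y [iota_inj splitQ]]]] := IHN R1 Q monQ szQ.
exists S, (iota \o j), (fun a => oapp y (iota x) (unlift ord0 a)); split.
  by apply: inj_comp => // a b /(congr1 val) /= ab; apply: polyC_inj.
rewrite map_poly_comp /= defQ rmorphM /= splitQ map_polyXsubC mulrC.
rewrite big_ord_recl unlift_none; congr (_ * _).
by apply: eq_bigr => a _; rewrite liftK.
Qed.

Lemma Epoly_splitting_exists (eta : seq nat) :
  exists (S : comNzRingType) (iota : {rmorphism {mpoly rat[size eta]} -> S})
    (y : 'I_(head 0%N eta) -> S), splits_with_roots iota (Epoly eta) y.
Proof.
have sz_tail : (size (\sum_(1 <= j < (head 0%N eta).+1)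
    (((-1) ^+ j * Ecoef eta j) *: 'X^(head 0%N eta - j)))%R
    < size ('X^(head 0%N eta) : {poly {mpoly rat[size eta]}})%R)%N.
  rewrite size_polyXn ltnS big_seq; apply: leq_trans (size_sum _ _ _) _.
  apply/bigmax_leqP_seq => j _; rewrite mem_index_iota => /andP[j_gt0 j_le].
  apply: (leq_trans (size_scale_leq _ _)); rewrite size_polyXn.
  by rewrite -subSn // leq_subLR -add1n leq_add2r.
apply: splitting_algebra_exists; last by rewrite size_polyDl // size_polyXn.
by rewrite monicE lead_coefDl // -monicE monicXn.
Qed.

(* Main.v *)
(* By the dual Cauchy identity, [\sum_mu m_mu(y) e_mu(x)] is
   [\prod_a \prod_c (1 + y_a x_c) = \prod_c \sum_j e_j(y) x_c^j], whose
   coefficient at a monomial [x^m] is the product of the [E_(m c)] over the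
   colors [c] used by [m], since [e_j(y) = E_j].  Expanding this product, a term
   chooses for each color [c] a part [f c] to lie in, and contributes to
   [u^eta] exactly when the colors sent to part [i] have total multiplicity
   [eta_i]; its coefficient [\prod_c 1 / (m c)!] times [eta!] is then the
   number of ways to distribute these colors over the vertices of the parts. *)

Require Import Defs.
From mathcomp Require Import all_boot all_order all_algebra fingroup perm.
From mathcomp Require Import finmap multiset.
From mathcomp Require Import mpoly.

Set Implicit Arguments.
Unset Strict Implicit.
Unset Printing Implicit Defensive.

Import GRing.Theory.
Local Open Scope ring_scope.

(** * Products of elementary symmetric series *)

Lemma size_msetB (d m : monomial) :
  msubset d m -> (size m = size d + size (msetB m d))%N.
Proof.
move=> sub_dm; rewrite -size_cat; apply/perm_size/allP => i _ /=.
rewrite count_cat !count_mem_mset msetE2 subnKC //.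
exact: (msubsetP sub_dm).
Qed.

Lemma msubset_subD (d e m : monomial) :
  msubset d m -> msubset e (msetB m d) = msubset (msetD d e) m.
Proof.
move=> sub_dm; apply/msubsetP/msubsetP => sub i; move: (sub i); rewrite !msetE2.
  by rewrite leq_subRL //; apply: (msubsetP sub_dm).
by rewrite leq_subRL //; apply: (msubsetP sub_dm).
Qed.

(** Divisors of a quotient become divisors of [m] under a condition symmetric in [d] and [e], ready
    for an exchange of sums. *)
Lemma sum_divisors_ofB (V : nmodType) (d m : monomial) (F : monomial -> V) :
    msubset d m ->
  \sum_(e <- divisors_of (msetB m d)) F e =
  \sum_(e <- divisors_of m | msubset (msetD d e) m) F e.
Proof.
move=> sub_dm; rewrite -[RHS]big_filter; apply: perm_big.
apply: uniq_perm; rewrite ?filter_uniq ?undup_uniq // => e.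
rewrite mem_filter !mem_divisors_of msubset_subD // andb_idr //.
move=> /msubsetP sub; apply/msubsetP => i.
by apply: leq_trans (sub i); rewrite msetE2 leq_addl.
Qed.

Lemma eq_series_mul (f g g' : series) :
  g =1 g' -> series_mul f g =1 series_mul f g'.
Proof. by move=> eq_g m; apply: eq_bigr => d _; rewrite eq_g. Qed.

(** Both sides expand over pairs of divisors [d], [e] with [msetD d e] dividing [m], so exchanging
    two sums suffices. Left-commutativity is what permuting the factors of a [foldr] requires. *)
Lemma series_mulCA (f g h : series) :
  series_mul f (series_mul g h) =1 series_mul g (series_mul f h).
Proof.
have expand a b m : series_mul a (series_mul b h) m =
    \sum_(d <- divisors_of m) \sum_(e <- divisors_of m | msubset (msetD d e) m)
       a d * b e * h (msetB m (msetD d e)).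
  rewrite /series_mul !big_seq; apply: eq_bigr => d.
  rewrite mem_divisors_of => sub_dm.
  rewrite big_distrr /= sum_divisors_ofB //; apply: eq_bigr => e _.
  rewrite mulrA; congr (_ * h _); apply/msetP => i.
  by rewrite !msetE2 subnDA.
move=> m; rewrite !expand (exchange_big_dep xpredT) //=; apply: eq_bigr => e _.
apply: eq_big => [d|d _]; first by rewrite msetDC.
by rewrite [a in a * _]mulrC msetDC.
Qed.

Lemma divisors_of_mset0 (m : monomial) : mset0 \in divisors_of m.
Proof. by rewrite mem_divisors_of; apply: msub0set. Qed.

(** As [e_0 = 1], only the empty divisor contributes; this makes zero padding of exponent vectors
    harmless. *)
Lemma elem_sym_part0 (mu : seq nat) :
  elem_sym_part (0%N :: mu) =1 elem_sym_part mu.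
Proof.
move=> m; rewrite /elem_sym_part /= /series_mul.
rewrite (bigD1_seq mset0) ?divisors_of_mset0 ?undup_uniq //=.
rewrite big1 ?addr0 => [|d d_neq0].
  rewrite /elem_sym enum_mset0 /= mul1r; congr (foldr _ _ _ _).
  by apply/msetP => i; rewrite msetE2 mset0E subn0.
by rewrite /elem_sym size_mset_eq0 (negPf d_neq0) andbF mul0r.
Qed.

Lemma elem_sym_part_cat_nseq0 (mu : seq nat) (k : nat) :
  elem_sym_part (mu ++ nseq k 0%N) =1 elem_sym_part mu.
Proof.
elim: mu => [|a mu IHmu]; last exact: eq_series_mul.
elim: k => [|k IHk] // m.
by rewrite -[LHS]/(elem_sym_part (0%N :: nseq k 0%N) m) elem_sym_part0 IHk.
Qed.

Lemma perm_elem_sym_part (mu nu : seq nat) :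
  perm_eq mu nu -> elem_sym_part mu =1 elem_sym_part nu.
Proof.
have move_to_front x s t :
    elem_sym_part (s ++ x :: t) =1 elem_sym_part (x :: s ++ t).
  elim: s => // a s IHs m.
  by rewrite -[RHS]series_mulCA; apply: eq_series_mul.
elim: mu nu => [|a mu IHmu] nu; first by rewrite perm_sym => /perm_nilP->.
move=> perm_nu; have /splitPr def_nu: a \in nu.
  by rewrite -(perm_mem perm_nu) mem_head.
case: def_nu perm_nu => s t perm_st m; rewrite move_to_front.
apply: eq_series_mul; apply: IHmu.
by rewrite -(perm_cons a) (permPl perm_st) -cat1s perm_catCA.
Qed.

(** Homogeneity: sizes add up under [series_mul], and [elem_sym a] is concentrated in size [a]. *)
Lemma elem_sym_part_size (mu : seq nat) (m : monomial) :
  size m != sumn mu -> elem_sym_part mu m = 0.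
Proof.
elim: mu m => [|a mu IHmu] m /=.
  by rewrite size_mset_eq0 /elem_sym_part /= /series_one => /negPf->.
move=> sz_m; apply: big1_seq => d; rewrite mem_divisors_of => /andP[_ sub_dm].
rewrite /elem_sym; case: eqP => [sz_d|_]; last by rewrite andbF mul0r.
rewrite [X in _ * X](IHmu (msetB m d)) ?mulr0 //.
by apply: contra_neq sz_m => <-; rewrite (size_msetB sub_dm) sz_d.
Qed.

(** * The dual Cauchy identity *)

Section ElementaryValues.
Variable S : comNzRingType.

(* [e_j(y)], as a coefficient of its generating polynomial. *)
Definition esym_at (N : nat) (y : 'I_N -> S) (j : nat) : S :=
  (\prod_(a < N) (1 + y a *: 'X))`_j.

Lemma esym_at0 (N : nat) (y : 'I_N -> S) : esym_at y 0 = 1.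
Proof.
by rewrite /esym_at coef0_prod big1 // => a _; rewrite coefD coef1 coefZ coefX mulr0 addr0.
Qed.

Lemma esym_at_recl (N : nat) (y : 'I_N.+1 -> S) (j : nat) : (0 < j)%N ->
  esym_at y j = y ord0 * esym_at (y \o lift ord0) j.-1 + esym_at (y \o lift ord0) j.
Proof.
move=> j_gt0; rewrite /esym_at big_ord_recl mulrDl mul1r -scalerAl coefD coefZ.
by rewrite coefXM gtn_eqF // addrC.
Qed.

End ElementaryValues.

(* These lists serve as exponent vectors of the monomials in [y]. *)
Fixpoint seqs_over (ks : seq nat) (N : nat) : seq (seq nat) :=
  if N is N'.+1 then
    [seq k :: alpha | k <- ks, alpha <- seqs_over ks N']
  else [:: [::]].

Lemma mem_seqs_over (ks : seq nat) (N : nat) (alpha : seq nat) :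
  (alpha \in seqs_over ks N) = (size alpha == N) && all (mem ks) alpha.
Proof.
elim: N alpha => [|N IHN] [|k alpha] //=.
  by apply/negP => /allpairsP[[k' alpha'] [_ _]].
apply/allpairsP/idP => [[[k' beta] [/= + + [-> ->]]]|].
  by rewrite IHN eqSS => -> /andP[-> ->].
by rewrite eqSS => /and3P[sz_al k_ks al_ks]; exists (k, alpha); rewrite IHN sz_al.
Qed.

Lemma seqs_over_uniq (ks : seq nat) (N : nat) : uniq ks -> uniq (seqs_over ks N).
Proof.
move=> uniq_ks; elim: N => //= N IHN; apply: allpairs_uniq => //.
by move=> [k a] [l b] _ _ [-> ->].
Qed.

Section DualCauchy.
Variable m : monomial.

Definition mset_of_supp (J : {set finsupp m}) : monomial :=
  seq_mset [seq val c | c <- enum J].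

Lemma mset_of_suppE (J : {set finsupp m}) (c : finsupp m) :
  mset_of_supp J (val c) = (c \in J).
Proof.
rewrite mset_seqE count_uniq_mem; last by rewrite map_inj_uniq ?enum_uniq //; apply: val_inj.
by rewrite mem_map ?mem_enum //; apply: val_inj.
Qed.

Lemma size_mset_of_supp (J : {set finsupp m}) : size (mset_of_supp J) = #|J|.
Proof. by rewrite (perm_size (perm_eq_seq_mset _)) size_map cardE. Qed.

(** [elem_sym] sees only squarefree divisors; indexing them by sets of colors of [m] turns divisor
    sums into the subset sums produced by distributivity. *)
Lemma uniq_divisorsE :
  perm_eq [seq d : monomial <- divisors_of m | uniq d]
          [seq mset_of_supp J | J : {set finsupp m}].
Proof.
apply: uniq_perm; first by rewrite filter_uniq ?undup_uniq.
  rewrite map_inj_uniq ?enum_uniq // => J K eqJK; apply/setP => c.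
  by apply: (can_inj oddb); rewrite -!mset_of_suppE eqJK.
move=> d; rewrite -[d]/(d : monomial) mem_filter mem_divisors_of; apply/andP/imageP.
  move=> [uniq_d sub_dm]; exists [set c : finsupp m | val c \in (d : monomial)] => //.
  apply/msetP => i; have [im|im] := boolP (i \in finsupp m); last first.
    rewrite [RHS]mset_seqE (count_memPn _).
      by apply/eqP; rewrite -leqn0 (leq_trans (msubsetP sub_dm i)) ?leqn0 ?mset_eq0 -?multiset.msuppE.
    by apply: contra im => /mapP[c _ ->]; apply: valP.
  rewrite -[i]/(val [` im]%fset) mset_of_suppE inE /=.
  by rewrite -[LHS]count_mem_mset count_uniq_mem.
move=> [J _ ->]; split.
  rewrite (perm_uniq (perm_eq_seq_mset _)) map_inj_uniq ?enum_uniq //.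
  exact: val_inj.
apply/msubsetP => i; have [im|im] := boolP (i \in finsupp m).
  rewrite -[i]/(val [` im]%fset) mset_of_suppE /=.
  by rewrite (leq_trans (leq_b1 _)) // mset_gt0 -multiset.msuppE.
rewrite mset_seqE (count_memPn _) //.
by apply: contra im => /mapP[c _ ->]; apply: valP.
Qed.

End DualCauchy.

Lemma prod_finsupp_sub (S : comNzRingType) (F : nat -> S) (d m : monomial) :
    F 0%N = 1 -> msubset d m ->
  \prod_(c <- finsupp d) F (d c) = \prod_(c : finsupp m) F (d (val c)).
Proof.
move=> F0 sub_dm; rewrite -(big_seq_fsetE _ (finsupp m) xpredT (fun c => F (d c))) /=.
apply: big_fset_incl => [|c _]; last by move/fsfun_dflt ->.
by apply/fsubsetP => c; rewrite !multiset.msuppE; apply: msubset_subset.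
Qed.

(* Coefficientwise form of [\prod_a \prod_c (1 + y_a x_c)], expanded along
   the alphabet [y] on the left and along the alphabet [x] on the right. *)
Lemma dual_cauchy_bounded (S : comNzRingType) (rho : {rmorphism rat -> S})
    (B N : nat) (y : 'I_N -> S) (m : monomial) : (size m <= B)%N ->
  \sum_(alpha <- seqs_over (iota 0 B.+1) N)
     (\prod_(a < N) y a ^+ nth 0%N alpha a) * rho (elem_sym_part alpha m)
  = \prod_(c <- finsupp m) esym_at y (m c).
Proof.
move: (iota 0 B.+1) (iota_uniq 0 B.+1) (mem_iota 0 B.+1) => ks uniq_ks mem_ks.
elim: N y m => [|N IHN] y m m_le.
  rewrite big_seq1 big_ord0 mul1r /elem_sym_part /= /series_one rmorph_nat.
  have [->|m_neq0] := eqVneq m mset0; first by rewrite finsupp0 big_nil.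
  have [c cm] : exists c, c \in finsupp m.
    apply/fset0Pn; apply: contra m_neq0 => /eqP supp0; apply/mset_eqP => i.
    by rewrite mset0E fsfun_dflt // supp0.
  rewrite (big_fsetD1 c) //= /esym_at big_ord0 coef1.
  by rewrite -(negbK (m c == 0)%N) -mem_finsupp cm mul0r.
pose y0 := y ord0; pose y' := y \o lift ord0.
(* Peel off [y ord0]: the head [k] of an exponent vector selects a squarefree divisor [d] with
   [size d = k], and the induction hypothesis treats [msetB m d]. *)
transitivity (\sum_(d <- [seq d : monomial <- divisors_of m | uniq d])
    y0 ^+ size d * \prod_(c <- finsupp (msetB m d)) esym_at y' (msetB m d c)).
  rewrite big_allpairs_dep.
  transitivity (\sum_(k <- ks) \sum_(d <- divisors_of m)
      (uniq (d : seq nat) && (size d == k))%:R * (y0 ^+ k *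
      \sum_(alpha <- seqs_over (ks) N) (\prod_(a < N) y' a ^+ nth 0%N alpha a) *
        rho (elem_sym_part alpha (msetB m d)))).
    apply: eq_bigr => k _.
    under [RHS]eq_bigr do rewrite !big_distrr /=.
    rewrite exchange_big /=; apply: eq_bigr => alpha _.
    rewrite big_ord_recl /= rmorph_sum big_distrr /=; apply: eq_bigr => d _.
    by rewrite rmorphM rmorph_nat -/(elem_sym_part alpha) !mulrA; congr (_ * _); rewrite mulrC mulrA.
  rewrite exchange_big [RHS]big_filter [RHS]big_mkcond /= !big_seq; apply: eq_bigr => d.
  rewrite mem_divisors_of => sub_dm; have sz_d := size_msetB sub_dm.
  have d_le : (size (d : monomial) <= B)%N by rewrite (leq_trans _ m_le) // sz_d leq_addr.
  rewrite IHN; last by rewrite (leq_trans _ m_le) // sz_d leq_addl.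
  (* Only [k = size d] survives, and it lies in [ks] because [size d <= B]. *)
  rewrite (bigD1_seq (size (d : monomial))) ?uniq_ks ?mem_ks //= [X in _ + X]big1 => [|k k_neq].
    by rewrite eqxx andbT addr0; case: uniq; rewrite ?mul1r ?mul0r.
  by rewrite eq_sym (negPf k_neq) andbF mul0r.
rewrite (perm_big _ (uniq_divisorsE m)) big_image /=.
rewrite [RHS]big_seq_fsetE /=.
under [RHS]eq_bigr => c _.
  rewrite esym_at_recl; last by rewrite mset_gt0 -multiset.msuppE; apply: valP.
  over.
(* [J] collects the colors [c] whose factor contributes [y0] times the elementary value of index
   [m c - 1], rather than the one of index [m c]. *)
rewrite bigA_distr /=; apply: eq_bigr => J _.
rewrite (@prod_finsupp_sub _ _ _ m) ?esym_at0 //; last exact: msubsetDl.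
rewrite size_mset_of_supp [RHS](eq_bigr (fun c => (if c \in J then y0 else 1) *
    esym_at y' (msetB m (mset_of_supp J) (val c)))) => [|c _].
  by rewrite [RHS]big_split /= -big_mkcond prodr_const.
rewrite msetE2 mset_of_suppE.
by case: (c \in J); rewrite ?mul1r ?subn1 ?subn0.
Qed.

(** * Grouping exponent vectors by partition *)

Definition positive_part_sort (alpha : seq nat) : seq nat :=
  sort geq [seq k <- alpha | 0 < k]%N.

Lemma sumn_positive_part_sort (alpha : seq nat) :
  sumn (positive_part_sort alpha) = sumn alpha.
Proof.
rewrite (perm_sumn (permEl (perm_sort _ _))).
by elim: alpha => //= -[|k] alpha //= ->.
Qed.

Lemma positive_part_sort_partition (n : nat) (alpha : seq nat) :
  is_partition n (positive_part_sort alpha) = (sumn alpha == n).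
Proof.
rewrite /is_partition sumn_positive_part_sort sort_sorted => [|a b]; last exact: leq_total.
by rewrite all_sort filter_all.
Qed.

(** A sorted sequence is determined by its multiset of entries, and parts are positive, so
    discarding zeros and sorting undoes padding and rearranging. *)
Lemma perm_pad_partition (n N : nat) (alpha mu : seq nat) :
    size alpha = N -> is_partition n mu ->
  (size mu <= N)%N && perm_eq alpha (mu ++ nseq (N - size mu) 0%N) =
  (mu == positive_part_sort alpha).
Proof.
move=> sz_al /and3P[sorted_mu pos_mu _]; apply/andP/eqP => [[_ perm_al]|def_mu].
  apply: (@sorted_eq _ geq) => //.
  - by move=> a b c /= ba ac; apply: leq_trans ac ba.
  - by move=> a b; rewrite andbC => /anti_leq.
  - by apply: sort_sorted => a b; apply: leq_total.
  rewrite perm_sym perm_sort.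
  rewrite (permPl (perm_filter (fun k => 0 < k)%N perm_al)).
  rewrite filter_cat (all_filterP pos_mu) -[X in perm_eq _ X]cats0 perm_cat2l.
  by elim: (N - _)%N.
have perm_mu : perm_eq mu [seq k <- alpha | 0 < k]%N by rewrite def_mu perm_sort.
split; first by rewrite (perm_size perm_mu) -sz_al size_filter count_size.
rewrite perm_sym -(permPr (permEl (perm_filterC (fun k => 0 < k)%N alpha))).
have -> : [seq k <- alpha | ~~ (0 < k)%N] = nseq (N - size mu) 0%N.
  rewrite (perm_size perm_mu) -sz_al size_filter.
  rewrite -(count_predC (fun k => 0 < k)%N alpha) addKn -size_filter.
  apply/all_pred1P/allP => k; rewrite mem_filter /= -leqNgt leqn0.
  by case/andP.
by rewrite perm_cat2r.
Qed.

(* Every exponent vector rearranges exactly one zero-padded partition. *)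
Lemma sum_msym_at (S : comNzRingType) (N n : nat) (y : 'I_N -> S)
    (f : seq nat -> S) :
    (forall mu nu, perm_eq mu nu -> f mu = f nu) ->
    (forall mu k, f (mu ++ nseq k 0%N) = f mu) ->
  \sum_(mu <- partitions n) msym_at y mu * f mu =
  \sum_(alpha <- seqs_over (iota 0 n.+1) N | sumn alpha == n)
     (\prod_(a < N) y a ^+ nth 0%N alpha a) * f alpha.
Proof.
move=> f_perm f_pad; pose G alpha := (\prod_(a < N) y a ^+ nth 0%N alpha a) * f alpha.
transitivity (\sum_(mu <- partitions n)
   \sum_(alpha <- seqs_over (iota 0 n.+1) N | mu == positive_part_sort alpha) G alpha).
  rewrite !big_seq; apply: eq_bigr => mu; rewrite mem_partitions => part_mu.
  have mem_eq alpha : alpha \in seqs_over (iota 0 n.+1) N ->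
      (mu == positive_part_sort alpha) =
      (size mu <= N)%N && perm_eq alpha (mu ++ nseq (N - size mu) 0%N).
    rewrite mem_seqs_over => /andP[/eqP sz_al _].
    by rewrite (perm_pad_partition sz_al part_mu).
  rewrite big_seq_cond (eq_bigl (fun alpha => (alpha \in seqs_over (iota 0 n.+1) N) &&
      ((size mu <= N)%N && perm_eq alpha (mu ++ nseq (N - size mu) 0%N)))); last first.
    by move=> alpha /=; case: (boolP (alpha \in _)) => //= /mem_eq ->.
  rewrite -big_seq_cond /msym_at; case: leqP => [sz_mu|_]; last first.
    by rewrite mul0r big_pred0.
  rewrite -big_filter big_distrl /= big_seq.
  rewrite (eq_bigr G) => [|alpha]; last first.
    rewrite mem_permutations => perm_al.
    by rewrite /G (f_perm _ _ perm_al) f_pad.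
  rewrite -big_seq; apply: perm_big; apply: uniq_perm.
  - exact: permutations_uniq.
  - exact: filter_uniq (seqs_over_uniq N (iota_uniq 0 n.+1)).
  move=> alpha; rewrite mem_filter mem_permutations andb_idr // => perm_al.
  rewrite mem_seqs_over (perm_size perm_al) size_cat size_nseq subnKC // eqxx.
  apply/allP => k; rewrite (perm_mem perm_al) mem_cat mem_nseq => k_in.
  suff: k \in iota 0 n.+1 by []; rewrite mem_iota; move: k_in.
  case/orP => [k_mu|/andP[_ /eqP->]] //.
  case/and3P: part_mu => _ _ /eqP <-.
  by rewrite add0n ltnS sumnE (big_rem k) //= leq_addr.
(* After the exchange, [alpha] meets only [mu = positive_part_sort alpha], which is a partition of
   [n] exactly when [alpha] sums to [n]. *)
rewrite (exchange_big_dep xpredT) //= [RHS]big_mkcond /=; apply: eq_bigr => alpha _.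
rewrite -big_filter -positive_part_sort_partition -mem_partitions.
case: ifPn => [al_in|al_notin].
  rewrite big_filter big_mkcond (bigD1_seq _ al_in) ?partitions_uniq //= eqxx.
  by rewrite big1 ?addr0 // => mu /negPf->.
by rewrite big_filter big1_seq // => mu /andP[/eqP-> ]; rewrite (negPf al_notin).
Qed.

(** * Symmetric functions of the roots *)

Section Roots.
Variables (S : comNzRingType) (N : nat) (y : 'I_N -> S).

Lemma esym_atE (j : nat) :
  esym_at y j = \sum_(A : {set 'I_N} | #|A| == j) \prod_(a in A) y a.
Proof.
rewrite /esym_at; under eq_bigr do rewrite addrC.
rewrite bigA_distr coef_sum [RHS]big_mkcond /=; apply: eq_bigr => A _.
rewrite -big_mkcond /= scaler_prod prodr_const coefZ coefXn eq_sym.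
by case: eqP => _; rewrite ?mulr1 ?mulr0.
Qed.

(** Vieta's formula: [A] is the set of factors contributing [- y a], and the others contribute
    ['X]. *)
Lemma coef_prod_XsubC (j : nat) : (j <= N)%N ->
  (\prod_(a < N) ('X - (y a)%:P))`_(N - j) = (-1) ^+ j * esym_at y j.
Proof.
move=> j_le; under eq_bigr do rewrite addrC -polyCN.
rewrite bigA_distr coef_sum esym_atE big_distrr [RHS]big_mkcond /=.
apply: eq_bigr => A _.
rewrite (bigID (mem A)) /= (eq_bigr (fun a => (- y a)%:P)) => [|a ->] //.
rewrite [X in _ * X](eq_bigr (fun=> 'X)) => [|a /negPf->] //.
rewrite -rmorph_prod prodrN coefCM.
have -> : \prod_(a < N | a \notin A) 'X = 'X^(N - #|A|) :> {poly S}.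
  have <- : #|~: A| = (N - #|A|)%N by rewrite cardsCs setCK card_ord.
  by rewrite -prodr_const; apply: eq_bigl => a; rewrite inE.
rewrite coefXn; have A_le : (#|A| <= N)%N by rewrite -[N in leqRHS]card_ord max_card.
rewrite eqn_sub2lE // eq_sym.
by case: eqP => [->|_]; rewrite ?mulr1 ?mulr0.
Qed.

Lemma esym_at_gt (j : nat) : (N < j)%N -> esym_at y j = 0.
Proof.
move=> j_gt; rewrite esym_atE big_pred0 // => A.
by rewrite ltn_eqF // (leq_ltn_trans (max_card _)) ?card_ord.
Qed.

End Roots.

Lemma partition_nth_le (n : nat) (eta : seq nat) (i : nat) :
  is_partition n eta -> (nth 0 eta i <= head 0 eta)%N.
Proof.
case: eta => [|a eta] /and3P[sorted_eta _ _]; first by rewrite nth_nil.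
have geq_trans : transitive geq by move=> c b d /= cb dc; apply: leq_trans dc cb.
have [i_lt|i_ge] := ltnP i (size (a :: eta)); last by rewrite nth_default.
exact: (sorted_leq_nth geq_trans leqnn 0%N sorted_eta 0%N i).
Qed.

(** The condition [0 < j] avoids the leading term, and [j <= head 0 eta] keeps the truncated
    exponents distinct, so a single summand remains. *)
Lemma coef_Epoly (eta : seq nat) (j : nat) :
    (0 < j <= head 0 eta)%N ->
  (Epoly eta)`_(head 0%N eta - j) = (-1) ^+ j * Ecoef eta j.
Proof.
case/andP => j_gt0 j_le; have N_gt0 := leq_trans j_gt0 j_le.
rewrite /Epoly coefD coefXn ltn_eqF ?add0r; last by rewrite ltn_subrL j_gt0.
rewrite coef_sum (bigD1_seq j) ?iota_uniq ?mem_index_iota ?j_gt0 //=.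
rewrite coefZ coefXn eqxx mulr1 big_seq_cond big1 ?addr0 // => k.
rewrite mem_index_iota ltnS => /andP[/andP[_ k_le] k_neq].
by rewrite coefZ coefXn eqn_sub2lE // eq_sym (negPf k_neq) mulr0.
Qed.

(** Up to [eta_1], compare coefficients by Vieta. Beyond it both sides vanish: no part reaches size
    [j], and there are fewer than [j] roots. *)
Lemma iota_Ecoef (n : nat) (eta : seq nat) (S : comNzRingType)
    (iota : {rmorphism {mpoly rat[size eta]} -> S}) (y : 'I_(head 0%N eta) -> S)
    (j : nat) :
    is_partition n eta -> splits_with_roots iota (Epoly eta) y -> (0 < j)%N ->
  iota (Ecoef eta j) = esym_at y j.
Proof.
move=> heta [_ splitE] j_gt0; have [j_le|j_gt] := leqP j (head 0%N eta).
  apply: (can_inj (signrMK j)); rewrite -coef_prod_XsubC // -splitE coef_map.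
  by rewrite coef_Epoly ?j_gt0 //= rmorphM rmorph_sign.
rewrite esym_at_gt // /Ecoef big_pred0 ?scaler0 ?rmorph0 // => i.
apply: negbTE; rewrite -ltnNge; apply: leq_ltn_trans j_gt.
exact: partition_nth_le heta.
Qed.

(** * Symmetric polynomials evaluated at the roots *)

(** The roots specialize formal variables, for which the fundamental theorem of symmetric
    polynomials is available. *)
Lemma msym_at_mmap (R S : comNzRingType) (rho : {rmorphism R -> S}) (N : nat)
    (y : 'I_N -> S) (mu : seq nat) :
  mmap rho y (msym_at (fun a => 'X_a : {mpoly R[N]}) mu) = msym_at y mu.
Proof.
rewrite /msym_at; case: ifP => _; last by rewrite rmorph0.
rewrite rmorph_sum; apply: eq_bigr => alpha _.
rewrite rmorph_prod; apply: eq_bigr => a _.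
by rewrite rmorphXn /= mmapX mmap1U.
Qed.

Lemma mesym_mmap (R S : comNzRingType) (rho : {rmorphism R -> S}) (N : nat)
    (y : 'I_N -> S) (j : nat) :
  mmap rho y (mesym N R j) = esym_at y j.
Proof.
rewrite esym_atE rmorph_sum; apply: eq_bigr => A _.
rewrite rmorph_prod; apply: eq_bigr => a _.
by rewrite /= mmapX mmap1U.
Qed.

(** Permuting the variables permutes the positions in exponent vectors, and the set of
    rearrangements of the padded [mu] is stable under this. *)
Lemma msym_at_symmetric (R : comNzRingType) (N : nat) (mu : seq nat) :
  msym_at (fun a => 'X_a : {mpoly R[N]}) mu \is symmetric.
Proof.
apply/issymP => s; rewrite /msym_at; case: leqP => [sz_mu|_]; last by rewrite msym0.
set pad := mu ++ _; have sz_pad : size pad = N by rewrite size_cat size_nseq subnKC.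
pose act (t : 'S_N) (alpha : seq nat) := [seq nth 0%N alpha (t a) | a : 'I_N].
have nth_act t alpha (a : 'I_N) : nth 0%N (act t alpha) a = nth 0%N alpha (t a).
  by rewrite (nth_map a) ?size_enum_ord // nth_ord_enum.
have act_perm t alpha : perm_eq alpha pad -> perm_eq (act t alpha) pad.
  move=> perm_al; rewrite -(permPr perm_al).
  have sz_al : size alpha = N by rewrite (perm_size perm_al).
  have {2}-> : alpha = [seq nth 0%N alpha a | a : 'I_N].
    by rewrite /image_mem (map_comp (nth 0%N alpha) val) val_enum_ord -sz_al -/(mkseq _ _) mkseq_nth.
  rewrite /act /image_mem (map_comp (fun a : 'I_N => nth 0%N alpha a) t).
  apply: perm_map; apply: uniq_perm; last 1 first.
  - move=> a; rewrite mem_enum; apply/mapP.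
    by exists (t^-1%g a); rewrite ?mem_enum ?permKV.
  - by rewrite (map_inj_uniq (@perm_inj _ t)) enum_uniq.
  exact: enum_uniq.
have act_inj t alpha beta : size alpha = N -> size beta = N ->
    act t alpha = act t beta -> alpha = beta.
  move=> sz_al sz_be eq_act; apply: (@eq_from_nth _ 0%N); first by rewrite sz_be.
  rewrite sz_al => i i_lt; have := nth_act t alpha (t^-1%g (Ordinal i_lt)).
  by rewrite eq_act nth_act permKV.
have szP alpha : alpha \in permutations pad -> size alpha = N.
  by rewrite mem_permutations => /perm_size->.
(* Acting by the inverse of [s] on exponents compensates [s] on variables, once the product is
   reindexed by [s]. *)
rewrite rmorph_sum /= [RHS](perm_big (map (act s^-1%g) (permutations pad))) /=; last first.
  have uniq_act : uniq (map (act s^-1%g) (permutations pad)).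
    rewrite map_inj_in_uniq ?permutations_uniq // => alpha beta /szP ? /szP ?.
    exact: act_inj.
  rewrite perm_sym; apply: uniq_perm => //; first exact: permutations_uniq.
  (* A duplicate-free image of the same length inside the list exhausts it. *)
  apply: (uniq_min_size uniq_act _ _).2; last by rewrite size_map.
  move=> _ /mapP[alpha + ->]; rewrite !mem_permutations; exact: act_perm.
rewrite big_map; apply: eq_bigr => alpha _.
rewrite rmorph_prod [RHS](reindex_inj (@perm_inj _ s)) /=; apply: eq_bigr => a _.
rewrite nth_act permK rmorphXn /= msymX; congr ('X_[_] ^+ _).
by apply/mnmP => b; rewrite !mnmE -(inj_eq (@perm_inj _ s)) permKV.
Qed.

(** * Counting colorings *)

Section ColorClasses.
Variables (I C : finType) (f : C -> I).

(** Here [ts] lists the part of each vertex and [g] gives the class size of each color: the colors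
    that [f] sends to a part must fill it exactly. *)
Definition balanced (ts : seq I) (g : C -> nat) : bool :=
  [forall i, (\sum_(c | f c == i) g c == count_mem i ts)%N].

(** Removing one vertex of part [t] and one use of [c] lowers both counts at [t] by one; [0 < g c]
    rules out truncation. *)
Lemma balanced_cons (t : I) (ts : seq I) (g : C -> nat) (c : C) :
    f c = t -> (0 < g c)%N ->
  balanced ts (fun b => g b - (c == b))%N = balanced (t :: ts) g.
Proof.
move=> fc gc; apply: eq_forallb => i; rewrite /=.
have [<-|t_neq] := eqVneq t i.
  rewrite [in LHS](bigD1 c) ?fc //= [in RHS](bigD1 c) ?fc //= eqxx add1n subn1.
  rewrite -[RHS]eqSS -[g c in RHS](prednK gc) addSn !eqSS; congr (_ + _ == _)%N.
  by apply: eq_bigr => b /andP[_]; rewrite eq_sym => /negPf->; rewrite subn0.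
rewrite add0n; congr (_ == _); apply: eq_bigr => b /eqP fb.
suff /negPf-> : c != b by rewrite subn0.
by apply: contra_neq t_neq => cb; rewrite -fc cb.
Qed.

(* Multinomial theorem, by induction on [ts]: taking ['X_c] from the factor of
   [t] lowers [g c] by one, which the factorials turn into a weight [g c], and
   for balanced [g] these weights add up to the multiplicity of [t]. *)
Lemma mcoeff_prod_color_sums (ts : seq I) (g : 'X_{1..#|C|}) :
  (\prod_(t <- ts) \sum_(c | f c == t) ('X_(enum_rank c) : {mpoly rat[#|C|]}))@_g
    * (\prod_c (g (enum_rank c))`!)%:R =
  (balanced ts (fun c => g (enum_rank c)) * \prod_i (count_mem i ts)`!)%:R.
Proof.
elim: ts g => [|t ts IHts] g.
  rewrite big_nil mcoeff1 -natrM [X in _ = (_ * X)%:R]big1 // muln1.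
  have -> : balanced [::] (fun c => g (enum_rank c)) = (g == 0%MM).
    apply/forallP/eqP => [bal|-> i]; last by rewrite big1 // => c _; rewrite mnm0E.
    apply/mnmP => c; rewrite mnm0E; have := bal (f (enum_val c)).
    by rewrite sum_nat_eq0 => /forall_inP/(_ (enum_val c) (eqxx _)); rewrite enum_valK => /eqP.
  by have [->|_] := eqVneq g 0%MM; rewrite ?mul0n // big1 // => c _; rewrite mnm0E.
rewrite big_cons mulr_suml (raddf_sum (mcoeff g)) mulr_suml /=.
set P := \prod_(_ <- _) _ in IHts *.
transitivity (\sum_(c | f c == t) (g (enum_rank c) *
    (balanced (t :: ts) (fun c => g (enum_rank c)) * \prod_i (count_mem i ts)`!))%:R : rat).
  apply: eq_bigr => c /eqP fc; rewrite mulrC -[_ * P]commr_mpolyX.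
  have [gc|gc] := posnP (g (enum_rank c)).
    rewrite gc mul0n; suff -> : (P * 'X_(enum_rank c))@_g = 0 by rewrite mulr0.
    apply/eqP; rewrite mcoeff_eq0 (perm_mem (msuppMX _ _)).
    apply/mapP => -[k _ def_g]; move: gc.
    by rewrite def_g mnmDE mnm1E eqxx.
  have Ug : (U_(enum_rank c) <= g)%MM.
    by apply/mnm_lepP => i; rewrite mnm1E; case: eqP => [<-|].
  rewrite -[X in _@_X](submK Ug) addmC mcoeffMX.
  rewrite -(balanced_cons _ fc gc).
  have gB b : (g - U_(enum_rank c))%MM (enum_rank b) = (g (enum_rank b) - (c == b))%N.
    by rewrite mnmBE mnm1E (inj_eq enum_rank_inj).
  have -> : \prod_b (g (enum_rank b))`! =
      (g (enum_rank c) * \prod_b ((g - U_(enum_rank c))%MM (enum_rank b))`!)%N.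
    rewrite (bigD1 c) //= [in RHS](bigD1 c) //= gB eqxx subn1 mulnA.
    have <- : (g (enum_rank c))`! = (g (enum_rank c) * (g (enum_rank c)).-1`!)%N.
      by rewrite -[in LHS](prednK gc) factS prednK.
    congr (_ * _)%N; apply: eq_bigr => b; rewrite eq_sym gB => /negPf->.
    by rewrite subn0.
  rewrite natrM -mulrA [X in _ * X]mulrC IHts -natrM; congr (_ * (_ * _))%:R.
  by congr nat_of_bool; apply: eq_forallb => i; under eq_bigr do rewrite gB.
rewrite -natr_sum -big_distrl /=; congr _%:R.
have [/forallP/(_ t)/eqP ->|] := boolP (balanced _ _); last by rewrite !mul0n muln0.
rewrite !mul1n /= eqxx (bigD1 t) //= [in RHS](bigD1 t) //= eqxx factS mulnA.
congr (_ * _)%N; apply: eq_bigr => i; rewrite eq_sym => /negPf->.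
by rewrite add0n.
Qed.

(** Expanding the product of color sums over [V] picks a color [k v] with [f (k v) = tau v] for each
    [v], and the resulting exponents are the class sizes. The count is thus a coefficient given by
    [mcoeff_prod_color_sums]. *)
Lemma card_color_classes (V : finType) (tau : V -> I) (g : C -> nat) :
  (#|[set k : {ffun V -> C} | [forall v, f (k v) == tau v] &&
       [forall c, #|[set v | k v == c]| == g c]]| * \prod_c (g c)`! =
   [forall i, \sum_(c | f c == i) g c == #|[set v | tau v == i]|] *
     \prod_i (#|[set v | tau v == i]|)`!)%N.
Proof.
pose gm : 'X_{1..#|C|} := [multinom g (enum_val c) | c < #|C|].
have gmE c : gm (enum_rank c) = g c by rewrite mnmE enum_rankK.
pose ts := [seq tau v | v : V].
have count_ts i : count_mem i ts = #|[set v | tau v == i]|.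
  by rewrite -sum1_count big_image_cond -sum1_card; apply: eq_bigl => v; rewrite inE.
have := mcoeff_prod_color_sums ts gm; rewrite big_image /=.
rewrite bigA_distr_big_dep /= (raddf_sum (mcoeff gm)) /=.
rewrite (eq_bigr (fun k : {ffun V -> C} =>
    [forall c, #|[set v | k v == c]| == g c]%:R)) => [|k _]; last first.
  rewrite mprodXE mcoeffX; congr _%:R; congr nat_of_bool.
  apply/eqP/forallP => [/mnmP eq_k c|eq_k].
    rewrite -gmE -eq_k mnm_sumE -sum1dep_card big_mkcond /=; apply/eqP/eq_bigr => v _.
    by rewrite mnm1E (inj_eq enum_rank_inj); case: eqP.
  apply/mnmP => c; rewrite -[c]enum_valK gmE -(eqP (eq_k _)) mnm_sumE -sum1dep_card.
  rewrite [RHS]big_mkcond; apply: eq_bigr => v _.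
  by rewrite mnm1E (inj_eq enum_rank_inj); case: eqP.
rewrite -natr_sum -natrM => /eqP; rewrite Num.Theory.eqr_nat => /eqP.
have -> : \prod_c (gm (enum_rank c))`! = \prod_c (g c)`! by under eq_bigr do rewrite gmE.
have -> : \prod_i (count_mem i ts)`! = \prod_i (#|[set v | tau v == i]|)`!.
  by under eq_bigr do rewrite count_ts.
have -> : balanced ts (fun c => gm (enum_rank c)) =
    [forall i, \sum_(c | f c == i) g c == #|[set v | tau v == i]|]%N.
  by apply: eq_forallb => i; rewrite count_ts; under eq_bigr do rewrite gmE.
move=> <-; congr (_ * _)%N; rewrite -sum1_card [in RHS]big_mkcond [LHS]big_mkcond /=.
apply: eq_bigr => k _; rewrite inE.
have -> : (k \in family (fun v => [pred c | f c == tau v])) = [forall v, f (k v) == tau v].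
  by apply/familyP/forallP => h v; have := h v.
by case: [forall v, _] => //=; case: [forall c, _].
Qed.

End ColorClasses.

(** * Proper colorings of complete multipartite graphs *)

Section Colorings.
Variables (eta : seq nat) (m : monomial).
Let G := complete_multipartite eta.

Lemma card_part (i : 'I_(size eta)) : #|[set v : G | tag v == i]| = nth 0%N eta i.
Proof.
pose h (j : 'I_(nth 0%N eta i)) : G := Tagged (fun i : 'I_(size eta) => 'I_(nth 0%N eta i)) j.
have h_inj : injective h by move=> a b /eqP; rewrite eq_Tagged => /eqP.
rewrite -[RHS]card_ord -cardsT -(card_imset setT h_inj); apply: eq_card => -[i' j].
rewrite inE /=; apply/eqP/imsetP => [eq_i|[j' _ /(congr1 tag)]] //.
by case: _ / (esym eq_i) j => j; exists j.
Qed.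

Lemma content_colorE (k : {ffun G -> finsupp m}) :
  (seq_mset [seq val (k v) | v : G] == m) =
  [forall c, #|[set v | k v == c]| == m (val c)].
Proof.
have cntE (c : finsupp m) :
    seq_mset [seq val (k v) | v : G] (val c) = #|[set v | k v == c]|.
  rewrite mset_seqE -sum1_count big_image_cond -sum1_card; apply: eq_bigl => v.
  by rewrite inE /= (inj_eq val_inj).
apply/eqP/forallP => [eq_m c|eq_m]; first by rewrite -cntE eq_m.
apply/msetP => i; have [im|im] := boolP (i \in finsupp m).
  by rewrite -[i]/(val [` im]%fset) cntE; apply/eqP.
rewrite (fsfun_dflt im) mset_seqE; apply/count_memPn.
by apply: contra im => /mapP[v _ ->]; apply: valP.
Qed.

(* Every color occurs, so a proper coloring determines the part that each
   color class lies in. *)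
Lemma chromatic_sf_multipartite :
  chromatic_sf G m = \sum_(f : {ffun finsupp m -> 'I_(size eta)})
    #|[set k : {ffun G -> finsupp m} | [forall v, f (k v) == tag v] &&
       [forall c, #|[set v | k v == c]| == m (val c)]]|%:R.
Proof.
rewrite -natr_sum; congr _%:R.
under [RHS]eq_bigr do rewrite -sum1_card big_mkcond /=.
(* For each [k] of content [m] it remains to count the compatible maps [f]: one if [k] is proper,
   none otherwise. *)
rewrite exchange_big /= -sum1_card big_mkcond; apply: eq_bigr => k _.
rewrite inE content_colorE.
under [RHS]eq_bigr do rewrite inE.
have [/forallP content_k|_] := boolP [forall c, #|[set v | k v == c]| == m (val c)]; last first.
  by rewrite andbF big1 // => f _; rewrite andbF.
have k_surj c : {v | k v == c}.
  apply: sigW; have : (0 < #|[set v | k v == c]|)%N.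
    by rewrite (eqP (content_k c)) mset_gt0 -multiset.msuppE; apply: valP.
  by case/card_gt0P => v; rewrite inE; exists v.
rewrite andbT -big_mkcond /=; under [RHS]eq_bigl do rewrite andbT.
have [prop_k|improp_k] := ifPn; last first.
  rewrite big_pred0 // => f; apply: contraNF improp_k => /forallP tag_k.
  apply/forallP => u; apply/forallP => v; apply/implyP.
  apply: contraNN => /eqP eq_k.
  by rewrite -(eqP (tag_k u)) -(eqP (tag_k v)) eq_k.
(* Vertices in different parts are always adjacent, so a color of a proper coloring stays within one
   part. *)
have tag_eq u v : k u = k v -> tag u = tag v.
  move=> eq_k; apply/eqP; apply: contraTT prop_k => tag_neq.
  apply/negP => /forallP/(_ u)/forallP/(_ v)/implyP/(_ tag_neq).
  by rewrite eq_k eqxx.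
rewrite (big_pred1 [ffun c => tag (sval (k_surj c))]) // => f /=.
apply/forallP/eqP => [tag_k|-> v]; last first.
  by rewrite ffunE; apply/eqP/tag_eq/eqP/(svalP (k_surj (k v))).
by apply/ffunP => c; rewrite ffunE -(eqP (tag_k _)) (eqP (svalP (k_surj c))).
Qed.

Lemma mcoeff_prod_Ecoef :
  (\prod_(c <- finsupp m) Ecoef eta (m c))@_(eta_mnm eta) =
  \sum_(f : {ffun finsupp m -> 'I_(size eta)})
    (\prod_(c : finsupp m) (m (val c))`!%:R^-1) *
    [forall i, \sum_(c | f c == i) m (val c) == nth 0 eta i]%N%:R.
Proof.
rewrite big_seq_fsetE /= scaler_prod mcoeffZ -big_distrr /=; congr (_ * _).
under eq_bigr do rewrite big_mkcond /=.
rewrite bigA_distr_bigA (raddf_sum (mcoeff _)) /=; apply: eq_bigr => f _.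
have [ge_m|] := boolP [forall c, m (val c) <= nth 0 eta (f c)]%N; last first.
  (* The cutoff [eta_i >= j] in [E_j] kills this term; the filling condition fails as well, since
     [m c] alone exceeds the size of part [f c]. *)
  rewrite negb_forall => /existsP[c lt_m].
  rewrite (bigD1 c) //= (negPf lt_m) mul0r mcoeff0.
  case: forallP => // /(_ (f c)); rewrite (bigD1 c) //= => /eqP sum_m.
  by move: lt_m; rewrite -sum_m leq_addr.
rewrite (eq_bigr (fun c => 'X_(f c) ^+ m (val c))) => [|c _]; last by rewrite (forallP ge_m).
rewrite mprodXnE mcoeffX; congr _%:R; congr nat_of_bool.
have sumE i : (\sum_c U_(f c) *+ m (val c))%MM i = (\sum_(c | f c == i) m (val c))%N.
  rewrite mnm_sumE [RHS]big_mkcond; apply: eq_bigr => c _.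
  by rewrite mulmnE mnm1E; case: eqP; rewrite ?mul1n ?mul0n.
apply/eqP/forallP => [/mnmP eq_m i|eq_m]; first by rewrite -sumE eq_m mnmE.
by apply/mnmP => i; rewrite sumE mnmE; apply/eqP.
Qed.

(** Both sides are sums over the same assignments [f]; clearing the factorials of the multiplicities
    reduces each term to [card_color_classes]. *)
Lemma chromatic_sf_mcoeff :
  chromatic_sf G m = (part_fact eta)%:R *
    (\prod_(c <- finsupp m) Ecoef eta (m c))@_(eta_mnm eta).
Proof.
rewrite chromatic_sf_multipartite mcoeff_prod_Ecoef big_distrr /=.
apply: eq_bigr => f _; rewrite prodfV -natr_prod.
have fact_neq0 : (\prod_(c : finsupp m) (m (val c))`!)%:R != 0 :> rat.
  by rewrite Num.Theory.pnatr_eq0 -lt0n prodn_gt0 // => c; apply: fact_gt0.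
apply: (mulIf fact_neq0); rewrite -natrM.
rewrite (card_color_classes f (fun v : G => tag v) (fun c => m (val c))).
rewrite [_^-1 * _]mulrC mulrA mulfVK // -natrM mulnC; congr _%:R.
congr (_ * _)%N; first by apply: eq_bigr => i _; rewrite card_part.
by congr nat_of_bool; apply: eq_forallb => i; rewrite card_part.
Qed.

Lemma chromatic_sf_size (n : nat) :
  is_partition n eta -> size m != n -> chromatic_sf G m = 0.
Proof.
case/and3P => _ _ /eqP sum_eta; apply: contraNeq.
rewrite /chromatic_sf Num.Theory.pnatr_eq0 cards_eq0 => /set0Pn[k].
rewrite inE => /andP[_ /eqP <-].
rewrite (perm_size (perm_eq_seq_mset _)) size_image -sum_eta sumnE (big_nth 0%N) big_mkord.
rewrite -sum1_card (partition_big (fun v : G => tag v) xpredT) //=.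
apply/eqP/eq_bigr => i _; rewrite -card_part -sum1_card.
by apply: eq_bigl => v; rewrite inE.
Qed.

End Colorings.

(** * Descent to the base ring and conclusion *)

Lemma rmorph_mmap (R S T : comNzRingType) (N : nat) (phi : {rmorphism S -> T})
    (f : {rmorphism R -> S}) (h : 'I_N -> S) (p : {mpoly R[N]}) :
  phi (mmap f h p) = mmap (phi \o f) (phi \o h) p.
Proof.
rewrite /mmap rmorph_sum; apply: eq_bigr => k _; rewrite rmorphM rmorph_prod.
by congr (_ * _); apply: eq_bigr => i _; rewrite rmorphXn.
Qed.

(** By the fundamental theorem [p] is a polynomial [t] in the elementary symmetric polynomials;
    replacing these by the [Ecoef] gives the preimage, with [j.+1] because ordinals start at [0].
    The sigma type lets preimages be chosen as a function of [mu]. *)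
Lemma iota_symmetric_in_roots (n : nat) (eta : seq nat) (S : comNzRingType)
    (iota : {rmorphism {mpoly rat[size eta]} -> S}) (y : 'I_(head 0%N eta) -> S)
    (p : {mpoly rat[head 0%N eta]}) :
    is_partition n eta -> splits_with_roots iota (Epoly eta) y ->
    p \is symmetric ->
  {q | iota q = mmap (iota \o @mpolyC (size eta) rat) y p}.
Proof.
move=> heta hy /sym_fundamental[t [<- _]].
exists (mmap (@mpolyC (size eta) rat) (fun j : 'I_(head 0%N eta) => Ecoef eta j.+1) t).
rewrite rmorph_mmap /comp_mpoly rmorph_mmap.
rewrite /mmap; apply: eq_bigr => k _; congr (_ * _); first by rewrite /= mmapC.
apply: mmap1_eq => j; rewrite /= (iota_Ecoef heta hy) // tnth_map tnth_ord_tuple.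
by rewrite mesym_mmap.
Qed.

Theorem theorem3p2 (n : nat) (eta : seq nat) (heta : is_partition n eta)
    (S : comNzRingType) (iota : {rmorphism {mpoly rat[size eta]} -> S})
    (y : 'I_(head 0%N eta) -> S)
    (hy : splits_with_roots iota (Epoly eta) y) :
  exists my : seq nat -> {mpoly rat[size eta]},
    (forall mu : seq nat, is_partition n mu -> iota (my mu) = msym_at y mu) /\
    (forall m : monomial,
       chromatic_sf (complete_multipartite eta) m =
       (part_fact eta)%:R *
         \sum_(mu <- partitions n) (my mu)@_(eta_mnm eta) * elem_sym_part mu m).
Proof.
pose rho : {rmorphism rat -> S} := iota \o @mpolyC (size eta) rat.
pose my mu := sval (iota_symmetric_in_roots heta hy (msym_at_symmetric rat _ mu)).
have myE mu : iota (my mu) = msym_at y mu.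
  by rewrite /my; case: (iota_symmetric_in_roots _ _ _) => q /= ->; rewrite (msym_at_mmap rho).
exists my; split=> // m.
(* Both sides are homogeneous of degree [n], so they vanish in every other degree. *)
have [sz_m|sz_m] := eqVneq (size m) n; last first.
  rewrite (chromatic_sf_size heta sz_m) big_seq big1 ?mulr0 // => mu.
  rewrite mem_partitions => /and3P[_ _ /eqP sum_mu].
  by rewrite elem_sym_part_size ?mulr0 // sum_mu.
rewrite chromatic_sf_mcoeff; congr (_ * _).
(* By linearity the coefficient is taken last, and injectivity of [iota] moves the comparison of
   polynomials to the algebra containing the roots. *)
transitivity ((\sum_(mu <- partitions n) elem_sym_part mu m *: my mu)@_(eta_mnm eta)); last first.
  by rewrite (raddf_sum (mcoeff _)); apply: eq_bigr => mu _; rewrite /= mcoeffZ mulrC.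
congr (_@_ _); case: (hy) => iota_inj _; apply: iota_inj.
rewrite rmorph_prod rmorph_sum /=.
transitivity (\sum_(mu <- partitions n) msym_at y mu * rho (elem_sym_part mu m)); last first.
  by apply: eq_bigr => mu _; rewrite -mul_mpolyC rmorphM mulrC -myE.
rewrite (@sum_msym_at _ _ n y (fun mu => rho (elem_sym_part mu m))).
(* As [m] has degree [n], exponent vectors with another sum contribute zero, so the sum may run over
   all bounded vectors, as in the dual Cauchy identity. *)
- rewrite [RHS]big_mkcond [RHS](eq_bigr (fun alpha => (\prod_a y a ^+ nth 0%N alpha a) *
      rho (elem_sym_part alpha m))) => [|alpha _]; last first.
    case: (eqVneq (sumn alpha) n) => // sum_al.
    by rewrite elem_sym_part_size ?rmorph0 ?mulr0 // sz_m eq_sym.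
  rewrite dual_cauchy_bounded ?sz_m // !big_seq; apply: eq_bigr => c c_m.
  by rewrite (iota_Ecoef heta hy) // mset_gt0 -multiset.msuppE.
- by move=> mu nu /perm_elem_sym_part ->.
- by move=> mu k; rewrite elem_sym_part_cat_nseq0.
Qed.
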